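(* Let $q$ be a prime power and $m,n$ positive integers. Then $$\left|\operatorname{TSRI}(m,n,q)\right|=\left|\Psi_I(\operatorname{TSRI}(m,n,q))\right|\prod_{i=1}^{m-1}(q^m-q^i).$$
   Context: $\operatorname{TSR}(m,n,q)$ denotes the set of $mn\times mn$ matrices $T$ over $\mathbb F_q$ which, viewed as $n\times n$ block matrices with $m\times m$ blocks, have the form: the block in position $(i+1,i)$ is $I_m$ for $i=1,\dots,n-1$; the last block column is $(c_0A, c_1A,\dots,c_{n-1}A)^{\top}$ for some $c_0,\dots,c_{n-1}\in\mathbb F_q$ and $A\in M_m(\mathbb F_q)$; all other blocks are zero. $\operatorname{TSRI}(m,n,q)$ is the set of $T\in\operatorname{TSR}(m,n,q)$ whose characteristic polynomial $\det(XI_{mn}-T)$ is irreducible over $\mathbb F_q$ (the irreducible TSRs of order $n$ over $\mathbb F_{q^m}$), and $\Psi_I(\operatorname{TSRI}(m,n,q))$ is the set of polynomials $\det(XI_{mn}-T)$ for $T\in\operatorname{TSRI}(m,n,q)$. *)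

(* Defs.v *)
From HB Require Import structures.
From mathcomp Require Import all_boot all_order all_algebra.
From mathcomp Require Import qpoly finmap.

Set Implicit Arguments.
Unset Strict Implicit.
Unset Printing Implicit Defensive.

Import GRing.Theory.
Local Open Scope ring_scope.

(* Blocks are indexed from 0: block (i.+1, i) is the identity and block
   (i, n.-1) is c i *: A. The type index \sum_(i < n) m, imposed by \mxblock,
   is equal to m * n. *)
Definition tsr_mx (F : finFieldType) (m n : nat)
    (c : {ffun 'I_n -> F}) (A : 'M[F]_m) : 'M[F]_(\sum_(i < n) m) :=
  \mxblock_(i < n, j < n)
    (if (j : nat) == n.-1 then c i *: A
     else if (i : nat) == j.+1 then 1%:M else 0).

Definition TSR (F : finFieldType) (m n : nat)
    : {set 'M[F]_(\sum_(i < n) m)} :=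
  [set T | [exists c : {ffun 'I_n -> F}, exists A : 'M[F]_m,
              T == tsr_mx c A]].

(* irreducibleb is the boolean counterpart of irreducible_poly
   (irreducibleP). *)
Definition TSRI (F : finFieldType) (m n : nat)
    : {set 'M[F]_(\sum_(i < n) m)} :=
  [set T in TSR F m n | irreducibleb (char_poly T)].

Definition PsiI (F : finFieldType) (m n : nat) : {fset {poly F}} :=
  [fset char_poly T | T in TSRI F m n]%fset.

(* Main.v *)
Require Import Defs.
From HB Require Import structures.
From mathcomp Require Import all_boot all_order all_algebra all_field.
From mathcomp Require Import qpoly finmap.

(** Write T = tsr_mx c A and g = \sum_i c_i X^i, and let f be its irreducible
    characteristic polynomial, z a root of f in F(z) = F[X]/(f). A left
    eigenvector of T for z has blocks w, z w, ..., z^(n-1) w with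
    g(z) w A = z^n w, so a = z^n / g(z) is an eigenvalue of A. Comparing
    degrees, [F(a) : F] = m and z has degree n over F(a), with minimal
    polynomial X^n - a g. If tsr_mx c' A' has the same characteristic
    polynomial and a' is its eigenvalue, F(a) = F(a') since F(z) has a unique
    subfield of each size; hence a g = a' g', so c and c' are proportional.
    Therefore the matrices with characteristic polynomial f are exactly the
    tsr_mx c B with B having the same irreducible characteristic polynomial as
    A. These B are counted through Krylov bases: (B, v) |-> (v B^i)_i maps
    bijectively the pairs with v nonzero onto GL_m(F). The case m = n = 1,
    where z may be 0, is separate: a 1 x 1 matrix is determined by its
    characteristic polynomial. *)

Set Implicit Arguments.
Unset Strict Implicit.
Unset Printing Implicit Defensive.

Import GRing.Theory.
Local Open Scope ring_scope.

(** * Counting matrices with a given irreducible characteristic polynomial *)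

Lemma char_poly_conj (R : comUnitRingType) (m : nat) (A Q : 'M[R]_m) :
  Q \in unitmx -> char_poly (invmx Q *m A *m Q) = char_poly A.
Proof.
move=> uQ; pose P := map_mx polyC Q; pose P' := map_mx polyC (invmx Q).
have P'P : P' *m P = 1%:M by rewrite -map_mxM mulVmx // map_mx1.
rewrite /char_poly /char_poly_mx !map_mxM.
have {1}-> : 'X%:M = P' *m 'X%:M *m P by rewrite scalar_mxC -mulmxA P'P mulmx1.
rewrite -mulmxBl -mulmxBr !det_mulmx mulrAC -det_mulmx.
by rewrite P'P det1 mul1r.
Qed.

Definition krylov_mx (F : fieldType) (m : nat) (v : 'rV[F]_m.+1)
    (B : 'M[F]_m.+1) : 'M[F]_m.+1 :=
  \matrix_(i < m.+1) (v *m B ^+ i).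

Section Krylov.

Variables (F : fieldType) (m : nat).
Implicit Types (v w : 'rV[F]_m.+1) (B Q : 'M[F]_m.+1).

Lemma row0_krylov v B : row 0 (krylov_mx v B) = v.
Proof. by rewrite rowK mulmx1. Qed.

Lemma mul_krylov v B w : w *m krylov_mx v B = v *m horner_mx B (rVpoly w).
Proof.
rewrite mulmx_sum_row /rVpoly; under eq_bigr do rewrite rowK.
rewrite poly_def raddf_sum mulmx_sumr; apply: eq_bigr => i _ /=.
by rewrite valK linearZ /= rmorphXn /= horner_mx_X -scalemxAr.
Qed.

(** A vector killed by the Krylov matrix is a polynomial h of degree at most m with v h(B) = 0. If h
    is nonzero, it is coprime to [char_poly B], so Bezout and Cayley-Hamilton make h(B) invertible,
    forcing v = 0. *)
Lemma krylov_unitmx v B :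
  irreducible_poly (char_poly B) -> v != 0 -> krylov_mx v B \in unitmx.
Proof.
move=> irrB v0; rewrite -row_free_unit; apply: inj_row_free => w.
rewrite mul_krylov; set h := rVpoly w => vh0.
have [h0|h0] := eqVneq h 0; first by rewrite -[w]rVpolyK -/h h0 raddf0.
have : coprimep (char_poly B) h.
  rewrite irreducible_poly_coprime //; apply/negP => /(dvdp_leq h0).
  by rewrite size_char_poly leqNgt ltnS size_poly.
case/Bezout_eq1_coprimepP => -[a b] /=.
rewrite [b * h]mulrC => /(congr1 (horner_mx B)).
rewrite rmorphD !rmorphM /= Cayley_Hamilton mulr0 add0r rmorph1 => hb.
case/eqP: v0; rewrite -[v]mulmx1 -[1%:M]hb.
by rewrite -[_ * _]/(_ *m _) mulmxA vh0 mul0mx.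
Qed.

(** The left factor is the companion matrix of [char_poly B], so an invertible Krylov matrix
    determines B once its characteristic polynomial is known. *)
Lemma krylov_intertwine v B :
  krylov_mx v B *m B =
    (\matrix_(i < m.+1) poly_rV ('X^(i.+1) %% char_poly B)) *m krylov_mx v B.
Proof.
apply/row_matrixP => i; rewrite !row_mul !rowK mul_krylov.
rewrite poly_rV_K; last first.
  by rewrite -ltnS -(size_char_poly B) ltn_modp monic_neq0 ?char_poly_monic.
rewrite -mulmxA -[_ *m B]/(_ * _) -exprSr -[in LHS](horner_mx_X B) -rmorphXn /=.
rewrite [in LHS](divp_eq 'X^(i.+1) (char_poly B)) rmorphD rmorphM /=.
by rewrite Cayley_Hamilton mulr0 add0r.
Qed.

Lemma krylov_conj v B Q : Q \in unitmx ->
  krylov_mx (v *m Q) (invmx Q *m B *m Q) = krylov_mx v B *m Q.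
Proof.
move=> uQ; apply/row_matrixP => i; rewrite row_mul !rowK -!mulmxA.
congr (_ *m _); elim: (i : nat) => [|k IH]; first by rewrite mulmx1 mul1mx.
by rewrite exprSr exprSr -!mulmxE mulmxA IH -!mulmxA mulKVmx.
Qed.

End Krylov.

Lemma card_char_poly_fiber_GL (F : finFieldType) (m : nat) (A : 'M[F]_m.+1) :
  irreducible_poly (char_poly A) ->
  (#|[set B : 'M[F]_m.+1 | char_poly B == char_poly A]| * (#|F| ^ m.+1 - 1))%N =
  #|'GL_m.+1[F]%g|.
Proof.
move=> irrA; set D := [set B | _].
have -> : (#|F| ^ m.+1 - 1)%N = #|[set v : 'rV[F]_m.+1 | v != 0]|.
  have <- : [set~ (0 : 'rV[F]_m.+1)] = [set v : 'rV[F]_m.+1 | v != 0].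
    by apply/setP => v; rewrite !inE.
  by rewrite cardsC1 card_mx mul1n subn1.
rewrite -cardsX cardsT card_sub.
pose k (x : 'M[F]_m.+1 * 'rV[F]_m.+1) := krylov_mx x.2 x.1.
rewrite -(@card_in_imset _ _ k); last first.
  move=> [B v] [B' v']; rewrite !inE /= => /andP[/eqP cB v0].
  move=> /andP[/eqP cB' _]; rewrite /k /= => e.
  have ev : v = v' by rewrite -(row0_krylov v B) e row0_krylov.
  subst v'; congr (_, _); have uK : krylov_mx v B \in unitmx.
    by apply: krylov_unitmx => //; rewrite cB.
  apply: (can_inj (mulKmx uK)); rewrite {2}e !krylov_intertwine cB cB'.
  by rewrite e.
apply: eq_card => P; rewrite !inE; apply/imsetP/idP => [[[B v]]|uP].
  rewrite !inE /= => /andP[/eqP cB v0] ->.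
  by apply: krylov_unitmx => //; rewrite cB.
(* Any nonzero w would do: with K the Krylov matrix of (w, A), conjugating by Q = K^-1 P turns K
   into K Q = P. *)
pose w : 'rV[F]_m.+1 := const_mx 1.
have w0 : w != 0.
  by apply/eqP => /rowP/(_ 0)/eqP; rewrite !mxE oner_eq0.
have uK := krylov_unitmx irrA w0.
pose Q := invmx (krylov_mx w A) *m P.
have uQ : Q \in unitmx by rewrite unitmx_mul unitmx_inv uK.
exists (invmx Q *m A *m Q, w *m Q).
  rewrite !inE /= char_poly_conj // eqxx /=; apply: contra w0 => /eqP e.
  by rewrite -[w](mulmxK uQ) e mul0mx.
by rewrite /k /= krylov_conj // mulKVmx.
Qed.

Lemma card_char_poly_fiber (F : finFieldType) (m : nat) (A : 'M[F]_m) :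
  (0 < m)%N -> irreducible_poly (char_poly A) ->
  #|[set B : 'M[F]_m | char_poly B == char_poly A]| =
  (\prod_(1 <= i < m) (#|F| ^ m - #|F| ^ i))%N.
Proof.
case: m A => // m A _ irrA; set q := #|F|.
have q1 : (1 < q)%N by apply: finRing_gt1.
have pos : (0 < q ^ m.+1 - 1)%N.
  by rewrite subn_gt0 -[1%N](exp1n m.+1) ltn_exp2r.
apply/eqP; rewrite -(eqn_pmul2r pos) card_char_poly_fiber_GL // card_GL // -/q.
apply/eqP.
transitivity (\prod_(0 <= i < m.+1) (q ^ m.+1 - q ^ i))%N; last first.
  by rewrite big_ltn // expn0 mulnC.
(* The power of q in the order of GL is spread over the reversed product, as q^(m+1) - q^i = q^i
   (q^(m+1-i) - 1). *)
rewrite -bin2_sum expn_sum big_add1 /=.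
rewrite [X in (_ * X)%N]big_nat_rev -big_split /=.
apply: eq_big_nat => i /andP[_ im]; rewrite add0n subSS mulnBr muln1 -expnD.
by rewrite -subSn // subnKC // ltnW.
Qed.

(** * Left eigenvectors of a TSR *)

Lemma map_mxblock (R S : Type) (f : R -> S) (p q : nat)
    (p_ : 'I_p -> nat) (q_ : 'I_q -> nat)
    (B : forall i j, 'M[R]_(p_ i, q_ j)) :
  map_mx f (\mxblock_(i, j) B i j) = \mxblock_(i, j) map_mx f (B i j).
Proof. by apply/matrixP => i j; rewrite !mxE. Qed.

Lemma scale_mxrow (R : pzRingType) (m q : nat) (q_ : 'I_q -> nat) (a : R)
    (V : forall j, 'M[R]_(m, q_ j)) :
  a *: (\mxrow_j V j) = \mxrow_j (a *: V j).
Proof. by apply/matrixP => i j; rewrite !mxE. Qed.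

Section TsrEigenvalues.

Variables (F : finFieldType) (E : fieldType) (f : {rmorphism F -> E}).
Variables (m n : nat).
Implicit Types (c : {ffun 'I_n.+1 -> F}) (A : 'M[F]_m) (z : E).

Definition tsr_eval c z : E := \sum_i f (c i) * z ^+ i.

Lemma mul_mxrow_tsr c A (V : nat -> 'rV[E]_m) :
  \mxrow_(i < n.+1) V i *m map_mx f (tsr_mx c A) =
  \mxrow_(j < n.+1) (if j == n :> nat
                     then (\sum_(i < n.+1) f (c i) *: V i) *m map_mx f A
                     else V j.+1).
Proof.
rewrite map_mxblock mul_mxrow_mxblock; apply/eq_mxrowP => j /=.
case: eqP => [_|/eqP jn].
  rewrite mulmx_suml; apply: eq_bigr => i _.
  by rewrite map_mxZ -scalemxAr scalemxAl.
have jS : (j.+1 < n.+1)%N by rewrite ltnS ltn_neqAle jn -ltnS ltn_ord.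
rewrite (bigD1 (Ordinal jS)) //= eqxx map_mx1 mulmx1 big1 ?addr0 // => i ij.
rewrite -[j.+1]/(val (Ordinal jS)) (inj_eq val_inj) (negPf ij).
by rewrite map_mx0 mulmx0.
Qed.

(** The identity blocks force block i to be z^i w, and the last block column gives the equation.
    Avoiding division keeps the case g(z) = 0 covered. *)
Lemma eigenvalue_tsrP c A z :
  eigenvalue (map_mx f (tsr_mx c A)) z <->
  (exists2 w : 'rV[E]_m,
     tsr_eval c z *: (w *m map_mx f A) = z ^+ n.+1 *: w & w != 0).
Proof.
split=> [/eigenvalueP [v]|[w wA w0]].
  pose V i : 'rV[E]_m := submxrow v (inord i : 'I_n.+1).
  have -> : v = \mxrow_(i < n.+1) V i.
    by rewrite -[LHS]submxrowK; apply/eq_mxrowP => i; rewrite /V inord_val.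
  rewrite mul_mxrow_tsr scale_mxrow => /eq_mxrowP H v0.
  have VE i : (i <= n)%N -> V i = z ^+ i *: V 0%N.
    elim: i => [|i IH] i_le; first by rewrite scale1r.
    have := H (inord i); rewrite inordK ?ltnS ?(ltnW i_le) // ltn_eqF // => ->.
    by rewrite IH ?(ltnW i_le) // scalerA exprS.
  exists (V 0%N).
    have := H ord_max; rewrite /= eqxx VE // scalerA -exprS => <-.
    rewrite scalemxAl scaler_suml; congr (_ *m _); apply: eq_bigr => i _.
    by rewrite (VE i) ?scalerA // -ltnS.
  apply: contra v0 => /eqP V0; apply/eqP; rewrite -[RHS]mxrow0.
  apply/eq_mxrowP => i; have i_le : (i <= n)%N by rewrite -ltnS.
  by rewrite VE // V0 scaler0.
apply/eigenvalueP; exists (\mxrow_(i < n.+1) (z ^+ i *: w)).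
  rewrite (mul_mxrow_tsr c A (fun i => z ^+ i *: w)) scale_mxrow.
  apply/eq_mxrowP => j; rewrite scalerA -exprS; case: eqP => [->|//].
  rewrite -wA scalemxAl scaler_suml; congr (_ *m _).
  by apply: eq_bigr => i _; rewrite scalerA.
apply: contra w0 => /eqP; rewrite -[X in _ = X]mxrow0 => /eq_mxrowP /(_ ord0).
by rewrite scale1r => ->.
Qed.

Lemma eigenvalue_tsr c A z : tsr_eval c z != 0 ->
  eigenvalue (map_mx f (tsr_mx c A)) z =
  eigenvalue (map_mx f A) (z ^+ n.+1 / tsr_eval c z).
Proof.
move=> g0; apply/idP/idP => [/eigenvalue_tsrP [w wA w0]|/eigenvalueP [w wA w0]].
  apply/eigenvalueP; exists w => //; apply: (scalerI g0); rewrite wA.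
  by rewrite scalerA mulrCA divff // mulr1.
apply/eigenvalue_tsrP; exists w => //; rewrite wA scalerA.
by rewrite mulrCA divff // mulr1.
Qed.

Lemma eigenvalue_tsr_eval_neq0 c A z :
  eigenvalue (map_mx f (tsr_mx c A)) z -> z != 0 -> tsr_eval c z != 0.
Proof.
move=> /eigenvalue_tsrP [w wA w0] z0; apply/eqP => g0; move: wA.
rewrite g0 scale0r => /esym/eqP.
by rewrite scaler_eq0 (negPf w0) orbF expf_eq0 (negPf z0).
Qed.

End TsrEigenvalues.

(** * Minimal polynomials over the base field and subfields of a finite field *)

Lemma map_poly_minPoly1 (F : fieldType) (L : fieldExtType F) (z : L)
    (p : {poly F}) :
  p \is monic -> root (map_poly (in_alg L) p) z ->
  (size p <= (\dim <<1; z>>%VS).+1)%N ->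
  map_poly (in_alg L) p = minPoly 1 z.
Proof.
move=> mp rp sp; have po : map_poly (in_alg L) p \is a polyOver 1%VS.
  by apply/polyOver1P; exists p.
have mL : map_poly (in_alg L) p \is monic by rewrite map_monic.
have dv := minPoly_dvdp po rp.
apply/eqP; rewrite -eqp_monic ?monic_minPoly // eqp_sym -dvdp_size_eqp //.
rewrite eqn_leq (dvdp_leq _ dv) ?monic_neq0 //= size_map_poly size_minPoly.
by rewrite (leq_trans sp) // dim_Fadjoin dimv1 muln1.
Qed.

Lemma irreducible_minPoly1 (F : fieldType) (L : fieldExtType F) (z : L)
    (p : {poly F}) :
  map_poly (in_alg L) p = minPoly 1 z -> irreducible_poly p.
Proof.
move=> pE; split=> [|r].
  by rewrite -(size_map_poly (in_alg L)) pE size_minPoly.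
move=> r1; rewrite -(dvdp_map (in_alg L)) pE => /minPoly_irr.
case/(_ _)/orP.
- by apply/polyOver1P; exists r.
- by rewrite -pE eqp_map.
- by rewrite -(rmorph1 (map_poly (in_alg L))) eqp_map -size_poly_eq1 (negPf r1).
Qed.

(** A subfield of dimension d is the solution set of x^(q^d) = x, where q = [#|F|]. *)
Lemma finField_subfield_dim_inj (F : finFieldType) (L : fieldExtType F)
    (K1 K2 : {subfield L}) :
  \dim K1 = \dim K2 -> K1 = K2.
Proof.
move=> e; apply/val_inj/vspaceP => x.
by rewrite !Fermat's_little_theorem e.
Qed.

(** * The eigenvalue a of A and the tower F, F(a), F(z) *)

Section TsrRoot.

Variables (F : finFieldType) (L : fieldExtType F) (m n : nat) (z : L).
Hypothesis m_gt0 : (0 < m)%N.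
Hypothesis dim_z : \dim <<1; z>>%VS = (m * n.+1)%N.
Hypothesis z0 : z != 0.

Local Notation ia := (in_alg L).
Implicit Types (c : {ffun 'I_n.+1 -> F}) (A : 'M[F]_m).

Definition tsr_root c : L := z ^+ n.+1 / tsr_eval ia c z.

Definition tsr_poly c : {poly L} := \poly_(i < n.+1) ia (c (inord i)).

Lemma horner_tsr_poly c : (tsr_poly c).[z] = tsr_eval ia c z.
Proof. by rewrite horner_poly; apply: eq_bigr => i _; rewrite inord_val. Qed.

Lemma tsr_polyOver c (K : {subfield L}) : tsr_poly c \is a polyOver K.
Proof.
apply/polyOverP => i; rewrite coef_poly; case: ifP => _; last exact: rpred0.
by rewrite /= rpredZ // rpred1.
Qed.

Section Eigenvalue.

Variables (c : {ffun 'I_n.+1 -> F}) (A : 'M[F]_m).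
Hypothesis ev : eigenvalue (map_mx ia (tsr_mx c A)) z.

Let c0 : tsr_eval ia c z != 0.
Proof. exact: eigenvalue_tsr_eval_neq0 ev z0. Qed.

Lemma tsr_root_neq0 : tsr_root c != 0.
Proof. by rewrite mulf_neq0 ?expf_neq0 ?invr_eq0. Qed.

Lemma eigenvalue_tsr_root : eigenvalue (map_mx ia A) (tsr_root c).
Proof. by rewrite -eigenvalue_tsr. Qed.

Lemma root_char_poly_tsr_root : root (map_poly ia (char_poly A)) (tsr_root c).
Proof. by rewrite map_char_poly -eigenvalue_root_char eigenvalue_tsr_root. Qed.

(** The first degree is at most m since a is a root of [char_poly A], the second at most n+1 since z
    is a root of X^(n+1) - a g over F(a). Their product is at least m(n+1), so both bounds are
    attained. *)
Lemma tsr_root_dims :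
  \dim <<1; tsr_root c>>%VS = m /\ adjoin_degree <<1; tsr_root c>>%VS z = n.+1.
Proof.
set a := tsr_root c; pose K := <<1; a>>%AS.
have dimK : (\dim K <= m)%N.
  rewrite dim_Fadjoin dimv1 muln1 -ltnS -size_minPoly -(size_char_poly A).
  rewrite -(size_map_poly ia); apply: dvdp_leq.
    by rewrite monic_neq0 // map_monic char_poly_monic.
  apply: minPoly_dvdp root_char_poly_tsr_root.
  by apply/polyOver1P; exists (char_poly A).
have degz : (adjoin_degree K z <= n.+1)%N.
  pose p := 'X^(n.+1) - a *: tsr_poly c.
  have szg : (size (- (a *: tsr_poly c)) < size ('X^(n.+1) : {poly L}))%N.
    rewrite size_polyN size_polyXn ltnS (leq_trans (size_scale_leq _ _)) //.
    exact: size_poly.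
  have szp : size p = n.+2 by rewrite size_polyDl // size_polyXn.
  (* Otherwise p, having z as a root and degree below that of z over K, would vanish, against
     [szp]. *)
  rewrite leqNgt; apply/negP => deg.
  have pK : p \is a polyOver K.
    rewrite rpredB ?rpredX ?polyOverX //.
    by rewrite polyOverZ ?memv_adjoin ?tsr_polyOver.
  have := root_small_adjoin_poly pK; rewrite szp => /(_ _ deg).
  rewrite -size_poly_eq0 szp /root !hornerE horner_tsr_poly.
  by rewrite /a /tsr_root divfK // subrr eqxx.
have : (m * n.+1 <= adjoin_degree K z * \dim K)%N.
  rewrite -dim_z -dim_Fadjoin; apply: dimvS.
  by apply/FadjoinP; rewrite sub1v memv_adjoin.
move: dimK degz; change <<1; a>>%VS with (K : {vspace L}).
set d := \dim K; set e := adjoin_degree K z => dm en le.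
have d_eq : d = m.
  apply/eqP; rewrite eqn_leq dm -(leq_pmul2r (ltn0Sn n)) (leq_trans le) //.
  by rewrite mulnC leq_mul2l en orbT.
split=> //; apply/eqP; rewrite eqn_leq en -(leq_pmul2l m_gt0) (leq_trans le) //.
by rewrite d_eq mulnC.
Qed.

Lemma char_poly_tsr_root : map_poly ia (char_poly A) = minPoly 1 (tsr_root c).
Proof.
apply: map_poly_minPoly1; rewrite ?char_poly_monic ?root_char_poly_tsr_root //.
by rewrite size_char_poly (proj1 tsr_root_dims).
Qed.

End Eigenvalue.

Lemma tsr_eval_proportional c c' A A' :
  eigenvalue (map_mx ia (tsr_mx c A)) z ->
  eigenvalue (map_mx ia (tsr_mx c' A')) z ->
  exists l : F, forall i, c' i = l * c i.
Proof.
move=> ev ev'; have a0' := tsr_root_neq0 ev'.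
set a := tsr_root c; set a' := tsr_root c' in a0'.
have [dK degz] := tsr_root_dims ev; have [dK' _] := tsr_root_dims ev'.
have KK' : <<1; a>>%AS = <<1; a'>>%AS.
  by apply: finField_subfield_dim_inj; rewrite /= dK.
(* Both terms take the value z^(n+1) at z and have coefficients in F(a), so p has root z and degree
   below that of z over F(a): it is zero. *)
pose p := a *: tsr_poly c - a' *: tsr_poly c'.
have pK : p \is a polyOver <<1; a>>%VS.
  rewrite rpredB // polyOverZ ?(tsr_polyOver _ <<1; a>>%AS) ?memv_adjoin //.
  by rewrite KK' memv_adjoin.
have szp : (size p <= adjoin_degree <<1; a>>%VS z)%N.
  rewrite degz (leq_trans (size_polyD _ _)) // geq_max size_polyN.
  by rewrite !(leq_trans (size_scale_leq _ _)) ?size_poly.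
have : root p z.
  rewrite /root !hornerE !horner_tsr_poly /a /a' /tsr_root !divfK ?subrr //.
    exact: eigenvalue_tsr_eval_neq0 ev' z0.
  exact: eigenvalue_tsr_eval_neq0 ev z0.
rewrite (root_small_adjoin_poly pK szp) subr_eq0 => /eqP cc.
have {cc} cc i : a * ia (c i) = a' * ia (c' i).
  have := congr1 (coefp i) cc.
  by rewrite /= !coefZ !coef_poly ltn_ord inord_val.
(* At such an i, comparing coefficients shows that a / a' is the element c' i / c i of F. *)
have [i ci0] : exists i, c i != 0.
  apply/existsP; apply: contraT => /existsPn H.
  have /eqP[] := eigenvalue_tsr_eval_neq0 ev z0; apply: big1 => i _.
  by rewrite (eqP (negbNE (H i))) rmorph0 mul0r.
exists (c' i / c i) => j.
have ac : a = a' * ia (c' i / c i).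
  by rewrite rmorphM fmorphV mulrA -cc mulfK // fmorph_eq0.
apply: (fmorph_inj ia); apply: (mulfI a0').
by rewrite -cc rmorphM mulrA -ac.
Qed.

End TsrRoot.

(** * Fibers of the characteristic polynomial on TSRs *)

Lemma tsr_mx_inj (F : finFieldType) (m n : nat) (c : {ffun 'I_n.+1 -> F}) :
  (exists i, c i != 0) -> injective (@tsr_mx F m n.+1 c).
Proof.
case=> i ci A B; rewrite /tsr_mx => /eq_mxblockP /(_ i ord_max) /=.
by rewrite eqxx; apply: scalerI.
Qed.

Lemma tsr_mxZ (F : finFieldType) (m n : nat) (c c' : {ffun 'I_n -> F})
    (l : F) (A : 'M[F]_m) :
  (forall i, c' i = l * c i) -> tsr_mx c' A = tsr_mx c (l *: A).
Proof.
by move=> cc'; apply/eq_mxblockP => i j; rewrite cc' scalerA mulrC.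
Qed.

Section Fibers.

Variables (F : finFieldType) (m n : nat) (c : {ffun 'I_n.+1 -> F}).
Variable (A : 'M[F]_m).
Hypothesis m_gt0 : (0 < m)%N.
Hypothesis mn_gt1 : (1 < m * n.+1)%N.
Hypothesis irrT : irreducible_poly (char_poly (tsr_mx c A)).

Lemma tsr_char_poly_fiber :
  [/\ irreducible_poly (char_poly A), injective (@tsr_mx F m n.+1 c) &
   [set T in TSR F m n.+1 | char_poly T == char_poly (tsr_mx c A)] =
   [set tsr_mx c B | B in [set B : 'M_m | char_poly B == char_poly A]]].
Proof.
have [L dimL [z rz Kz]] := irredp_FAdjoin irrT.
have dim_z : \dim <<1; z>>%VS = (m * n.+1)%N.
  by rewrite Kz dimL size_char_poly /= sum_nat_const card_ord mulnC.
have z0 : z != 0.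
  (* A zero z would generate only F, of dimension 1. *)
  apply: contraTneq mn_gt1 => z0.
  by rewrite -dim_z z0 dim_Fadjoin adjoin0_deg dimv1.
have ev_root d (T : 'M[F]_d) : eigenvalue (map_mx (in_alg L) T) z =
    root (map_poly (in_alg L) (char_poly T)) z.
  by rewrite map_char_poly -eigenvalue_root_char.
have evT : eigenvalue (map_mx (in_alg L) (tsr_mx c A)) z by rewrite ev_root.
have pA := char_poly_tsr_root m_gt0 dim_z z0 evT.
have g0 := eigenvalue_tsr_eval_neq0 evT z0.
split; first exact: irreducible_minPoly1 pA.
  apply: tsr_mx_inj; apply/existsP; apply: contraT => /existsPn H.
  case/eqP: g0; apply: big1 => i _.
  by rewrite (eqP (negbNE (H i))) rmorph0 mul0r.
apply/setP => T; rewrite !inE; apply/andP/imsetP => [[]|[B]].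
  case/existsP => c' /existsP [A' /eqP ->] /eqP e.
  have evT' : eigenvalue (map_mx (in_alg L) (tsr_mx c' A')) z.
    by rewrite ev_root e.
  have [l cc'] := tsr_eval_proportional m_gt0 dim_z z0 evT evT'.
  (* Moving l from c' into A' gives both matrices the same c, hence the same a, whose minimal
     polynomial is both characteristic polynomials. *)
  rewrite (tsr_mxZ _ cc') in evT' *; exists (l *: A') => //; rewrite inE.
  apply/eqP/(map_poly_inj (in_alg L)); rewrite pA.
  exact: char_poly_tsr_root evT'.
rewrite inE => /eqP pB ->; split.
  by apply/existsP; exists c; apply/existsP; exists B.
(* Conversely, a is an eigenvalue of B, so z is one of [tsr_mx c B]; by degree, its characteristic
   polynomial is the minimal polynomial of z. *)
have evB : eigenvalue (map_mx (in_alg L) (tsr_mx c B)) z.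
  rewrite eigenvalue_tsr // eigenvalue_root_char -map_char_poly pB.
  exact: root_char_poly_tsr_root evT.
apply/eqP/(map_poly_inj (in_alg L)).
have mE (S : 'M[F]_(\sum_(i < n.+1) m)) : eigenvalue (map_mx (in_alg L) S) z ->
    map_poly (in_alg L) (char_poly S) = minPoly 1 z.
  move=> evS; apply: map_poly_minPoly1; first exact: char_poly_monic.
    by rewrite -ev_root.
  by rewrite size_char_poly dim_z /= sum_nat_const card_ord mulnC.
by rewrite (mE _ evB) (mE _ evT).
Qed.

End Fibers.

(** * Counting by fibers *)

Lemma card_imfset_fibers (I : finType) (K : choiceType) (S : {set I})
    (h : I -> K) (k : nat) :
  (forall x, x \in S -> #|[set y in S | h y == h x]| = k) ->
  #|S| = (#|` [fset h x | x in S]%fset| * k)%N.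
Proof.
move=> Hk; rewrite card_fset_sum1 big_distrl /= -sum1_card.
set fs := [fset h x | x in S]%fset.
transitivity (\sum_(x in S) \sum_(y <- fs | y == h x) 1)%N.
  apply: eq_bigr => x xS; rewrite (big_rem (h x)) /= ?in_imfset // eqxx.
  rewrite big_seq_cond big1 ?addn0 //.
  move=> y /andP[]; rewrite mem_rem_uniq ?fset_uniq // !inE.
  by case: eqP.
rewrite (exchange_big_dep xpredT) //= big_seq [RHS]big_seq; apply: eq_bigr => y.
case/imfsetP => x /= xS ->; rewrite mul1n -(Hk x xS) -sum1_card.
by apply: eq_bigl => u; rewrite inE eq_sym.
Qed.

(** The constant coefficient is minus the trace, that is, minus the only entry. The size is kept as
    a variable because it is a sum over blocks where this applies. *)
Lemma char_poly_inj1 (R : comNzRingType) (d : nat) :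
  d = 1%N -> injective (@char_poly R d).
Proof.
move=> -> A B e; have := congr1 (fun p : {poly R} => p`_0) e.
rewrite -[0%N]/(1.-1)%N !char_poly_trace // => /oppr_inj.
by rewrite !trace_mx11 => AB; rewrite [A]mx11_scalar [B]mx11_scalar AB.
Qed.

Lemma card_TSRI_fiber (F : finFieldType) (m n : nat)
    (T : 'M[F]_(\sum_(i < n) m)) :
  (0 < m)%N -> (0 < n)%N -> T \in TSRI F m n ->
  #|[set T' in TSRI F m n | char_poly T' == char_poly T]| =
  (\prod_(1 <= i < m) (#|F| ^ m - #|F| ^ i))%N.
Proof.
case: n T => // n T m0 _ TS; have := TS; rewrite inE => /andP[TT irrT].
have -> : [set T' in TSRI F m n.+1 | char_poly T' == char_poly T] =
          [set T' in TSR F m n.+1 | char_poly T' == char_poly T].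
  apply/setP => T'; rewrite !inE -andbA.
  by case: (char_poly T' =P _) => [->|]; rewrite ?irrT ?andbF ?andbT.
have [mn|mn] := ltnP 1 (m * n.+1).
  move: TT irrT; rewrite inE.
  case/existsP => c /existsP [A /eqP ->] /irreducibleP irrT.
  have [irrA inj_c ->] := tsr_char_poly_fiber m0 mn irrT.
  by rewrite card_imset // card_char_poly_fiber.
(* One block of size 1: the fiber is the singleton of T and the product is empty. *)
have {mn} /andP[/eqP m1 /eqP n1] : (m == 1%N) && (n == 0%N).
  by rewrite -(eqSS n) -muln_eq1 eqn_leq mn muln_gt0 m0.
subst m n; rewrite [RHS]big_geq // -[RHS](cards1 T); apply: eq_card => T'.
rewrite !inE; apply/andP/eqP => [[_ /eqP]|->].
  by apply: char_poly_inj1; rewrite big_ord1.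
by move: TT; rewrite inE.
Qed.

Local Close Scope ring_scope.

Theorem theorem3p2 (q : nat) (F : finFieldType) (hq : #|F| = q)
    (m n : nat) (hm : 0 < m) (hn : 0 < n) :
  #|TSRI F m n| =
  (#|` PsiI F m n| * \prod_(1 <= i < m) (q ^ m - q ^ i))%N.
Proof.
rewrite -hq; apply: card_imfset_fibers => T TS.
exact: card_TSRI_fiber.
Qed.
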